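(* Let $p\in(2,\infty)$ and let $\xi$ be a centered non-zero real-valued random variable with $\mathbb{E}|\xi|^p<\infty$. Then \[\mathbb{P}(\xi\ge 0)\ \ge\ \mathbb{P}(\xi>0)\ \ge\ \frac14\,c_{p,2}^{-\frac{2p}{p-2}}\Big(\big(3-\tfrac4p\big)^{-\frac{1}{p-2}}+1\Big)\ \ge\ \frac{e^{-1}+1}{4}\,c_{p,2}^{-\frac{2p}{p-2}}.\]
   Context: A real-valued random variable $\xi$ is centered if $\mathbb{E}|\xi|<\infty$ and $\mathbb{E}\xi=0$; non-zero means that $\xi$ is not almost surely equal to $0$. For a random variable $\xi$ and $q\in[1,\infty)$, $c_q=(\mathbb{E}|\xi|^q)^{1/q}$, and $c_{p,2}=c_p/c_2$. *)

(* Defs.v *)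
From HB Require Import structures.
From mathcomp Require Import all_boot all_order all_algebra.
From mathcomp Require Import all_classical all_reals all_analysis.

Set Implicit Arguments.
Unset Strict Implicit.
Unset Printing Implicit Defensive.

Import Order.TTheory GRing.Theory Num.Theory.
Import numFieldNormedType.Exports.

Local Open Scope classical_set_scope.
Local Open Scope ring_scope.
Local Open Scope ereal_scope.

Definition centered (d : measure_display) (T : measurableType d)
    (R : realType) (P : probability T R) (X : {RV P >-> R}) : Prop :=
  'E_P[fun w => `|X w|%R] < +oo /\ 'E_P[X] = 0.

Definition nonzero (d : measure_display) (T : measurableType d)
    (R : realType) (P : probability T R) (X : {RV P >-> R}) : Prop :=
  ~ {ae P, forall w, X w = 0%R}.

(* c_q = (E|X|^q)^(1/q). The value is 0 if the moment is infinite; it is only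
   meant for q >= 1 and X with finite q-th absolute moment. *)
Definition cnorm (d : measure_display) (T : measurableType d)
    (R : realType) (P : probability T R) (X : {RV P >-> R}) (q : R) : R :=
  fine 'N[P]_(q%:E)[EFin \o X].

Definition cratio (d : measure_display) (T : measurableType d)
    (R : realType) (P : probability T R) (X : {RV P >-> R}) (p q : R) : R :=
  (cnorm X p / cnorm X q)%R.

(* Main.v *)
Require Import Defs.
From HB Require Import structures.
From mathcomp Require Import all_boot all_order all_algebra.
From mathcomp Require Import all_classical all_reals all_analysis.
From mathcomp Require Import measurable_realfun.
From mathcomp Require Import ring lra.

Set Implicit Arguments.
Unset Strict Implicit.
Unset Printing Implicit Defensive.

(** The lower bound on P(X > 0) is a duality argument.  For a scale l > 0 the
    test function
      g(x) = (p-2) l x + (p-1) l^2 x^2 - l^p |x|^p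
    is at most 0 for x <= 0 and at most M for x > 0, where M is its maximum.
    Since E X = 0, taking expectations in g(X) <= M 1_(X > 0) gives
      (p-1) l^2 E X^2 - l^p E|X|^p <= M P(X > 0)
    ([positive_probability_ge]).  The left side is largest for
    l = x0 (c_2^2 / c_p^p)^(1/(p-2)) with x0 = (2 - 2/p)^(1/(p-2)), and equals
    then (p-1)(p-2)/p * x0^2 * c_{p,2}^(-2p/(p-2)).

    The maximum M need not be computed.  Let u = 3 - 4/p.  Any z that lies to
    the right of the maximiser, in the sense that
      2 (p-1) z^2 + (p-2) z <= p z^p,
    gives M <= (p-1)(p-2)/p * z (1 + z) by two instances of Bernoulli's
    inequality ([test_function_le_pos]), so the claim reduces to finding such
    a z with z (1 + z) (1 + u^(-1/(p-2))) <= 4 x0^2.  The choice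
      z = x0 (2 - r),   r = exp (- 1 / (2 (p-1)))
    works ([exists_threshold]): one has x0 >= 1/r and u^(-1/(p-2)) <= r^2, so
    that z (1 + z) <= 2 x0^2 (2 - r), and what is left is
      (1 + r^2) (2 - r) <= 2,   that is,   r (1 - r)^2 >= 0. *)

Import Order.TTheory GRing.Theory Num.Theory.
Import numFieldNormedType.Exports.

Local Open Scope classical_set_scope.
Local Open Scope ring_scope.

(** * Real inequalities *)

Section RealInequalities.
Context {R : realType}.
Implicit Types p q r s w x y z : R.

(** Young's inequality for the product w * 1 with exponent q. *)
Lemma bernoulli_powR q w : 1 < q -> 0 <= w -> 1 + q * (w - 1) <= w `^ q.
Proof.
move=> q1 w0.
have q0 : 0 < q by lra.
have qn0 : q != 0 by rewrite gt_eqF.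
have conj : q^-1 + ((q - 1) / q)^-1^-1 = 1 by rewrite invrK; field.
have c0 : 0 < ((q - 1) / q)^-1 by rewrite invr_gt0 divr_gt0 // subr_gt0.
have := conjugate_powR w0 ler01 q0 c0 conj.
rewrite powR1 invrK mulr1 mul1r -mulrDl ler_pdivlMr // => h.
by lra.
Qed.

(** For s < 1 this is the bound 2 s <= ln ((1 + s) / (1 - s)), correct to
    second order in s.  The difference (1 + x) exp (-x) - (1 - x) exp x vanishes
    at 0 and has derivative x (exp x - exp (-x)) >= 0. *)
Lemma expR2_le_cayley s : 0 <= s -> (1 - s) * expR (2 * s) <= 1 + s.
Proof.
move=> s0.
pose f x : R := (1 + x) * expR (- x) - (1 - x) * expR x.
have df x : is_derive x 1 f (x * (expR x - expR (- x))).
  rewrite /f; apply: is_derive_eq.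
  by rewrite /GRing.scale /=; ring.
have : f 0 <= f s.
  apply: (@ger0_derive1_le_cc _ f 0 s) => //; last 2 first.
  - by rewrite in_itv /= lexx.
  - by rewrite in_itv /= lexx s0.
  - move=> x; rewrite in_itv /= => /andP[x0 _].
    rewrite derive1E (derive_val (is_derive := df x)).
    by rewrite mulr_ge0 ?ltW // subr_gt0 ltr_expR; lra.
  - apply: continuous_subspaceT => x.
    by apply: differentiable_continuous; apply/derivable1_diffP.
rewrite /f oppr0 expR0 !mulr1 !addr0 subrr subr_ge0 => h.
have := ler_wpM2r (expR_ge0 s) h.
rewrite -!mulrA -!expRD addNr expR0 mulr1.
by rewrite (_ : s + s = 2 * s) //; ring.
Qed.


(** The value of (p-2) x + (p-1) x^2 - x^p at x = z when z is a critical
    point, the power z^p being eliminated through the critical equation. *)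
Definition majorant_level p z := (p - 1) * (p - 2) / p * (z * (1 + z)).

(** With x = z w, the hypothesis on z replaces z^p w^p by a combination of
    z w^p and z^2 w^p; what remains are the inequalities w - w^p / p <= 1 - 1/p
    and w^2 - 2 w^p / p <= 1 - 2/p, weighted by (p-2) z and (p-1) z^2.  There is
    equality at x = z if z is a critical point. *)
Lemma test_function_le_pos p z x : 2 < p -> 0 < z ->
  2 * (p - 1) * z ^+ 2 + (p - 2) * z <= p * z `^ p -> 0 <= x ->
  (p - 2) * x + (p - 1) * x ^+ 2 - x `^ p <= majorant_level p z.
Proof.
move=> p2 z0 hz x0; have p0 : 0 < p by lra.
have pn0 : p != 0 by rewrite gt_eqF.
pose w := x / z.
have w0 : 0 <= w by rewrite divr_ge0 // ltW.
have -> : x = z * w by rewrite /w mulrC divfK // gt_eqF.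
have young1 : 1 + p * (w - 1) <= w `^ p by apply: bernoulli_powR => //; lra.
have young2 : 1 + p / 2 * (w ^+ 2 - 1) <= w `^ p.
  have -> : w `^ p = (w ^+ 2) `^ (p / 2).
    rewrite -powR_mulrn // -powRrM; congr (_ `^ _); by field.
  by apply: bernoulli_powR; [lra | rewrite exprn_ge0].
rewrite powRM // ?(ltW z0) //.
have zp := ler_wpM2r (powR_ge0 w p) hz.
have A : 0 <= (p - 2) * z by rewrite mulr_ge0 ?ltW //; lra.
have B : 0 <= 2 * (p - 1) * z ^+ 2.
  by rewrite !mulr_ge0 ?exprn_ge0 ?ltW //; lra.
have k1 := ler_wpM2l A young1.
have k2 := ler_wpM2l B young2.
rewrite /majorant_level -(ler_pM2l p0).
have -> : p * ((p - 1) * (p - 2) / p * (z * (1 + z)))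
    = (p - 1) * (p - 2) * (z * (1 + z)) by field.
nra.
Qed.

(** Tangency at y = 1: this is y times Bernoulli's inequality for the exponent
    p - 1, and it dictates the ratio of the coefficients p - 2 and p - 1 of the
    test function. *)
Lemma test_function_le_neg p y : 2 < p -> 0 <= y ->
  (p - 1) * y ^+ 2 - y `^ p <= (p - 2) * y.
Proof.
move=> p2 y0.
have h : 1 + (p - 1) * (y - 1) <= y `^ (p - 1).
  by apply: bernoulli_powR => //; lra.
have := ler_wpM2l y0 h.
by rewrite mulr_powRB1 //; [nra | lra].
Qed.

(** With t = 1/(p-1) and s = (p-2) t / 2 one has 2 - 2/p = 1 / (1 - s) >= exp s
    and 3 - 4/p = (1 + s) / (1 - s) >= exp (2 s), and s / (p-2) = t / 2 turns
    these into bounds on x0 and on (3 - 4/p)^(-1/(p-2)) by powers of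
    r = exp (-t/2).  The witness is z = x0 (2 - r): it is explicit, and
    (2 - r)^(p-2) >= 1 + s r is just what places z beyond the maximiser. *)
Lemma exists_threshold p (x0 := (2 - 2 / p) `^ (1 / (p - 2))) : 2 < p ->
  exists z, [/\ 0 < z,
    2 * (p - 1) * z ^+ 2 + (p - 2) * z <= p * z `^ p &
    z * (1 + z) * ((3 - 4 / p) `^ (- (1 / (p - 2))) + 1) <= 4 * x0 ^+ 2].
Proof.
move=> p2.
have [p0 p10 p20] : [/\ 0 < p, 0 < p - 1 & 0 < p - 2] by split; lra.
have [pn0 pn1 pn2] : [/\ p != 0, p - 1 != 0 & p - 2 != 0].
  by rewrite !gt_eqF.
pose t := (p - 1)^-1; pose s := (p - 2) * t / 2; pose r := expR (- (t / 2)).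
have t0 : 0 < t by rewrite invr_gt0.
have s0 : 0 < s by rewrite divr_gt0 ?mulr_gt0.
have s1 : s < 1.
  by rewrite /s /t ltr_pdivrMr // ltr_pdivrMr //; lra.
have r0 : 0 < r by rewrite expR_gt0.
have r1 : r < 1 by rewrite expR_lt1 oppr_lt0 divr_gt0.
have mE : 2 - 2 / p = (1 - s)^-1.
  by rewrite /s /t; field; rewrite ?pn0 ?pn1 /= gt_eqF //; lra.
have uE : 3 - 4 / p = (1 + s) / (1 - s).
  by rewrite /s /t; field; rewrite ?pn0 ?pn1 /= gt_eqF //; lra.
have m0 : 0 < 2 - 2 / p by rewrite mE invr_gt0 subr_gt0.
have u0 : 0 < 3 - 4 / p by rewrite uE divr_gt0 //; lra.
have m_ge : expR s <= 2 - 2 / p.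
  rewrite mE -[expR s]invrK -expRN lef_pV2 ?posrE ?expR_gt0 ?subr_gt0 //.
  exact: expR_ge1Dx.
have u_ge : expR (2 * s) <= 3 - 4 / p.
  by rewrite uE ler_pdivlMr ?subr_gt0 // mulrC expR2_le_cayley // ltW.
have ap : 0 < 1 / (p - 2) by rewrite divr_gt0.
have x0_gt0 : 0 < x0 by rewrite powR_gt0.
have rx0 : 1 <= r * x0.
  have : expR s `^ (1 / (p - 2)) <= x0.
    by apply: ge0_ler_powR; rewrite ?nnegrE ?expR_ge0 ?(ltW ap) ?(ltW m0) ?(ltW u0).
  rewrite -expRM (_ : s * _ = t / 2); last by rewrite /s; field.
  by move/(ler_wpM2l (ltW r0)); rewrite -expRD addNr expR0.
have u_le : (3 - 4 / p) `^ (- (1 / (p - 2))) <= r ^+ 2.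
  rewrite powRN -[r ^+ 2]invrK lef_pV2 ?posrE ?powR_gt0 ?invr_gt0 ?exprn_gt0 //.
  have : expR (2 * s) `^ (1 / (p - 2)) <= (3 - 4 / p) `^ (1 / (p - 2)).
    by apply: ge0_ler_powR; rewrite ?nnegrE ?expR_ge0 ?(ltW ap) ?(ltW m0) ?(ltW u0).
  rewrite -expRM -expRM_natl -expRN.
  by rewrite (_ : 2 * s * _ = - (2%:R * (- (t / 2)))) // /s; field.
(* Bernoulli with exponent 1/r gives 2 - r >= (1/r)^r = exp (r t / 2). *)
have pow2r_ge : expR (s * r) <= (2 - r) `^ (p - 2).
  have h : expR (t / 2) <= (2 - r) `^ (r^-1).
    have := @bernoulli_powR r^-1 (2 - r).
    rewrite invf_gt1 // => /(_ r1) => /(_ ltac:(lra)).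
    rewrite (_ : 1 + _ = r^-1); last by field; rewrite gt_eqF.
    by rewrite -expRN opprK.
  have := ge0_ler_powR (mulr_ge0 (ltW r0) (ltW p20)) _ _ h.
  rewrite !nnegrE expR_ge0 powR_ge0 => /(_ isT isT).
  rewrite -expRM -powRrM mulKf ?gt_eqF //.
  by rewrite (_ : t / 2 * (r * (p - 2)) = s * r) // /s; ring.
exists (x0 * (2 - r)); set z := x0 * (2 - r).
have r2 : 0 < 2 - r by lra.
have z0 : 0 < z by rewrite mulr_gt0.
have rz : 1 <= r * z.
  by rewrite /z mulrA; nra.
split => //.
- have zp2 : 2 * (p - 1) + (p - 2) * r <= p * z `^ (p - 2).
    have -> : z `^ (p - 2) = (2 - 2 / p) * (2 - r) `^ (p - 2).
      rewrite powRM ?ltW // -powRrM (_ : 1 / (p - 2) * _ = 1); last by field.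
      by rewrite powRr1 // ltW.
    have h : 1 + s * r <= (2 - r) `^ (p - 2).
      exact: le_trans (expR_ge1Dx _) pow2r_ge.
    rewrite mulrA (_ : p * (2 - 2 / p) = 2 * (p - 1)); last by field.
    have k0 : 0 <= 2 * (p - 1) by lra.
    apply: le_trans (ler_wpM2l k0 h).
    by rewrite le_eqVlt; apply/orP; left; apply/eqP; rewrite /s /t; field.
  have -> : z `^ p = z ^+ 2 * z `^ (p - 2).
    rewrite -powR_mulrn ?ltW // -powRD; last by rewrite (gt_eqF z0) implybT.
    by congr (_ `^ _); ring.
  have := ler_wpM2l (exprn_ge0 2 (ltW z0)) zp2.
  rewrite mulrCA; apply: le_trans.
  have := ler_wpM2l (mulr_ge0 (ltW p20) (ltW z0)) rz.
  by nra.
- have zz : z * (1 + z) <= 2 * x0 ^+ 2 * (2 - r).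
    have : 1 + z <= 2 * x0 by rewrite /z; nra.
    by move/(ler_wpM2l (ltW z0)); rewrite /z; nra.
  have kr : (2 - r) * (r ^+ 2 + 1) <= 2.
    have : 0 <= r * (1 - r) ^+ 2 by rewrite mulr_ge0 ?sqr_ge0 ?ltW.
    by nra.
  apply: le_trans (_ : z * (1 + z) * (r ^+ 2 + 1) <= _).
    by rewrite ler_wpM2l ?lerD2r // mulr_ge0 ?ltW //; lra.
  have r21 : 0 <= r ^+ 2 + 1 by rewrite addr_ge0 ?sqr_ge0.
  apply: le_trans (ler_wpM2r r21 zz) _.
  have := ler_wpM2l (mulr_ge0 (ler0n _ 2) (sqr_ge0 x0)) kr.
  by rewrite -!mulrA; lra.
Qed.

(** From 3 - 4/p = 1 + 2 (p-2) / p <= 1 + (p-2) <= exp (p-2). *)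
Lemma expRN1_le_powR p : 2 < p ->
  expR (-1) <= (3 - 4 / p) `^ (- (1 / (p - 2))).
Proof.
move=> p2.
have [p0 p20] : 0 < p /\ 0 < p - 2 by split; lra.
have [pn0 pn2] : p != 0 /\ p - 2 != 0 by rewrite !gt_eqF.
have u1 : 3 - 4 / p = 1 + 2 * (p - 2) / p by field.
have u0 : 0 < 3 - 4 / p by rewrite u1 addr_gt0 // divr_gt0 ?mulr_gt0.
rewrite powRN expRN lef_pV2 ?posrE ?expR_gt0 ?powR_gt0 //.
have h : 3 - 4 / p <= expR (p - 2).
  apply: le_trans (expR_ge1Dx _); rewrite u1 lerD2l ler_pdivrMr //; nra.
have ap : 0 <= 1 / (p - 2) by rewrite divr_ge0 // ltW.
have := ge0_ler_powR ap _ _ h; rewrite !nnegrE expR_ge0 (ltW u0) => /(_ isT isT).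
by rewrite -expRM mul1r mulfV.
Qed.

End RealInequalities.

(** * Moments and the expectation of the test function *)

Section Moments.
Context {R : realType} {d : measure_display} {T : measurableType d}.
Context {P : probability T R} {X : {RV P >-> R}}.
Implicit Types p q : R.

Definition absmoment q : R := \int[P]_w (`|X w| `^ q).

Lemma measurable_powR_norm q : measurable_fun setT (fun w => `|X w| `^ q).
Proof.
apply: (measurableT_comp (measurable_powR q)).
exact: measurableT_comp.
Qed.

Lemma measurable_preimage_itv (i : interval R) : measurable (X @^-1` [set` i]).
Proof. exact: measurable_funPTI. Qed.

Lemma gt0_preimage_itv : [set w | 0 < X w] = X @^-1` `]0, +oo[.
Proof. by apply/seteqP; split => w /=; rewrite in_itv /= andbT. Qed.

Lemma ge0_preimage_itv : [set w | 0 <= X w] = X @^-1` `[0, +oo[.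
Proof. by apply/seteqP; split => w /=; rewrite in_itv /= andbT. Qed.

Lemma integrable_powR_norm q : ('E_P[fun w => (`|X w| `^ q)%R] < +oo)%E ->
  P.-integrable setT (EFin \o (fun w => `|X w| `^ q)).
Proof.
rewrite unlock => h; apply/integrableP; split.
  by apply/measurable_EFinP; exact: measurable_powR_norm.
apply: le_lt_trans h; rewrite le_eqVlt; apply/orP; left; apply/eqP.
by apply: eq_integral => w _ /=; rewrite ger0_norm ?powR_ge0.
Qed.

(** The second moment is dominated through x^2 <= 1 + |x|^p. *)
Lemma integrable_powR_norm2 p : 2 < p ->
  ('E_P[fun w => (`|X w| `^ p)%R] < +oo)%E ->
  P.-integrable setT (EFin \o (fun w => `|X w| `^ 2)).
Proof.
move=> p2 /integrable_powR_norm ip.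
have i1 : P.-integrable setT (EFin \o (cst 1 : T -> R)).
  exact: finite_measure_integrable_cst.
apply: le_integrable (integrableD measurableT i1 ip) => //.
  by apply/measurable_EFinP; exact: measurable_powR_norm.
move=> w _ /=; rewrite lee_fin [leLHS]ger0_norm ?powR_ge0 //.
rewrite [leRHS]ger0_norm ?addr_ge0 ?powR_ge0 //.
have [x1|x1] := leP `|X w| 1.
  apply: le_trans (_ : 1 <= _); last by rewrite lerDl powR_ge0.
  by rewrite powR_mulrn // exprn_ile1.
apply: le_trans (_ : `|X w| `^ p <= _); last by rewrite lerDr.
by rewrite ler_powR ?ltW.
Qed.

(** Holds for infinite moments as well, both sides being then 0 because
    [fine] sends infinity to 0. *)
Lemma cnorm_powR q : 0 < q -> cnorm X q `^ q = absmoment q.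
Proof. by move=> q0; rewrite /cnorm -fine_poweR powR_Lnorm // gt_eqF. Qed.

Lemma cnorm_gt0 q : 0 < q -> nonzero X ->
  P.-integrable setT (EFin \o (fun w => `|X w| `^ q)) ->
  0 < cnorm X q.
Proof.
move=> q0 nz iq; rewrite lt0r fine_ge0 ?Lnorm_ge0 // andbT.
apply/negP => /eqP c0; apply: nz.
have I0 : (\int[P]_w (`|(X w)%:E| `^ q) = 0)%E.
  have := cnorm_powR q0; rewrite c0 powR0 ?gt_eqF // /absmoment /Rintegral.
  move=> h; rewrite -[LHS]fineK; first by congr EFin.
  exact: (integrable_fin_num measurableT iq).
have N0 : ('N[P]_(q%:E)[EFin \o X] = 0)%E.
  by rewrite unlock /= I0 poweR_EFin powR0 // invr_eq0 gt_eqF.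
have mX : measurable_fun setT (EFin \o X) by apply/measurable_EFinP.
have := Lnorm_eq0_eq0 mX _ N0; rewrite lte_fin => /(_ q0).
by apply: filterS => w /= /(_ I) [].
Qed.

(** The expectation of the pointwise bound on the test function at l X; the
    linear term contributes nothing because X is centered. *)
Lemma positive_probability_ge p z l : 2 < p -> 0 < z -> 0 < l ->
  2 * (p - 1) * z ^+ 2 + (p - 2) * z <= p * z `^ p ->
  centered X -> ('E_P[fun w => (`|X w| `^ p)%R] < +oo)%E ->
  (p - 1) * l ^+ 2 * absmoment 2 - l `^ p * absmoment p
    <= majorant_level p z * fine (P [set w | 0 < X w]).
Proof.
move=> p2 z0 l0 hz [X1 EX0] hXp.
have ip := integrable_powR_norm hXp.
have i2 := integrable_powR_norm2 p2 hXp.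
have i1 : P.-integrable setT (EFin \o X).
  apply/integrableP; split; first exact/measurable_EFinP.
  by move: X1; rewrite unlock; apply: le_lt_trans; rewrite lexx.
have mA : measurable [set w | 0 < X w].
  by rewrite gt0_preimage_itv; exact: measurable_preimage_itv.
set A := [set w | 0 < X w] in mA *.
have iA : P.-integrable setT (EFin \o (\1_A : T -> R)).
  exact: integrable_indic.
have EX : \int[P]_w X w = 0.
  by move: EX0; rewrite unlock /Rintegral => ->.
have EA : \int[P]_w (\1_A w : R) = fine (P A).
  by rewrite /Rintegral integral_indic // setIT.
have iZ k (f : T -> R) : P.-integrable setT (EFin \o f) ->
    P.-integrable setT (EFin \o (fun w => k * f w)).
  by move=> /(integrableZl measurableT k).
pose f w := ((p - 2) * l * X w + (p - 1) * l ^+ 2 * `|X w| `^ 2)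
            + (- l `^ p) * `|X w| `^ p.
have i12 : P.-integrable setT
    (EFin \o (fun w => (p - 2) * l * X w + (p - 1) * l ^+ 2 * `|X w| `^ 2)).
  exact: (integrableD measurableT (iZ _ _ i1) (iZ _ _ i2)).
have i_f : P.-integrable setT (EFin \o f).
  exact: (integrableD measurableT i12 (iZ _ _ ip)).
have -> : (p - 1) * l ^+ 2 * absmoment 2 - l `^ p * absmoment p
    = \int[P]_w f w.
  rewrite /f RintegralD //; last exact: iZ.
  rewrite RintegralD //; [|exact: iZ|exact: iZ].
  by rewrite !RintegralZl // EX mulr0 add0r mulNr.
rewrite -EA -RintegralZl //.
apply: le_Rintegral => //; first exact: iZ.
move=> w _; rewrite /f powR_mulrn // mulNr -powRM ?(ltW l0) //.
rewrite indicE; have [Xpos|Xneg] := ltP 0 (X w).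
  rewrite mem_set // mulr1 gtr0_norm //.
  have := test_function_le_pos p2 z0 hz (mulr_ge0 (ltW l0) (ltW Xpos)).
  by rewrite exprMn !mulrA.
rewrite memNset /=; last by apply/negP; rewrite -leNgt.
rewrite mulr0 ler0_norm //.
have y0 : 0 <= l * - X w by rewrite mulr_ge0 ?oppr_ge0 ?(ltW l0).
have := test_function_le_neg p2 y0.
by rewrite exprMn; lra.
Qed.

End Moments.

(** * The bound on the probability of positivity *)

Unset Implicit Arguments.

Theorem mainTheorem3 (R : realType) (d : measure_display)
  (T : measurableType d) (P : probability T R) (X : {RV P >-> R}) (p : R)
  (hp : 2 < p) (hX : centered X) (hX0 : nonzero X)
  (hXp : ('E_P[fun w => (`|X w| `^ p)%R] < +oo)%E) :
  [/\ (P [set w | (0 < X w)%R] <= P [set w | (0 <= X w)%R])%E,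
      ((4^-1 * cratio X p 2 `^ (- (2 * p / (p - 2)))
          * ((3 - 4 / p) `^ (- (1 / (p - 2))) + 1))%:E
        <= P [set w | (0 < X w)%R])%E
    & (expR (-1) + 1) / 4 * cratio X p 2 `^ (- (2 * p / (p - 2)))
        <= 4^-1 * cratio X p 2 `^ (- (2 * p / (p - 2)))
             * ((3 - 4 / p) `^ (- (1 / (p - 2))) + 1)].
Proof.
have [p0 p20] : 0 < p /\ 0 < p - 2 by split; lra.
have [pn0 pn2] : p != 0 /\ p - 2 != 0 by rewrite !gt_eqF.
split; last first.
- rewrite mulrC [leLHS](_ : _ = 4^-1 * cratio X p 2 `^ (- (2 * p / (p - 2)))
    * (expR (-1) + 1)); last by field.
  rewrite ler_wpM2l ?lerD2r ?expRN1_le_powR //.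
  by rewrite mulr_ge0 ?powR_ge0 // invr_ge0.
- have ip := integrable_powR_norm hXp.
  have i2 := integrable_powR_norm2 hp hXp.
  have cp0 := cnorm_gt0 p0 hX0 ip.
  have c20 := cnorm_gt0 (ltr0n _ 2) hX0 i2.
  have Mp := cnorm_powR p0.
  have M2 := cnorm_powR (ltr0n _ 2).
  have [z [z0 hz z_le]] := exists_threshold hp.
  set x0 := (2 - 2 / p) `^ (1 / (p - 2)) in z_le.
  set v := (_ `^ _ + 1) in z_le *.
  have m0 : 0 < 2 - 2 / p.
    by rewrite (_ : 2 - 2 / p = 2 * (p - 1) / p) ?divr_gt0 ?mulr_gt0 //;
      [lra | field].
  (* l = x0 mu maximises (p-1) l^2 c_2^2 - l^p c_p^p. *)
  pose mu := (cnorm X 2 ^+ 2 / cnorm X p `^ p) `^ (1 / (p - 2)).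
  have ratio0 : 0 < cnorm X 2 ^+ 2 / cnorm X p `^ p.
    by rewrite divr_gt0 ?exprn_gt0 ?powR_gt0.
  pose l := x0 * mu.
  have x0_gt0 : 0 < x0 by rewrite powR_gt0.
  have mu0 : 0 < mu by rewrite powR_gt0.
  have l0 : 0 < l by rewrite mulr_gt0.
  set C := cratio X p 2 `^ _.
  have CE : mu ^+ 2 * cnorm X 2 ^+ 2 = C.
    have r0 : 0 < cratio X p 2 by rewrite divr_gt0.
    apply: ln_inj; rewrite ?posrE ?(powR_gt0 _ r0) //.
      by rewrite mulr_gt0 ?exprn_gt0.
    rewrite lnM ?posrE ?exprn_gt0 // !lnXn // /mu !ln_powR /cratio.
    rewrite !ln_div ?posrE ?exprn_gt0 ?powR_gt0 // lnXn // ln_powR.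
    by field.
  have lp : l `^ p * absmoment (X := X) p
      = (2 - 2 / p) * (l ^+ 2 * cnorm X 2 ^+ 2).
    have -> : l `^ p = l ^+ 2 * l `^ (p - 2).
      rewrite -powR_mulrn ?(ltW l0) // -powRD; last by rewrite (gt_eqF l0) implybT.
      by congr (_ `^ _); ring.
    have -> : l `^ (p - 2) = (2 - 2 / p) * (cnorm X 2 ^+ 2 / cnorm X p `^ p).
      rewrite powRM ?ltW // -!powRrM (_ : 1 / (p - 2) * _ = 1); last by field.
      by rewrite !powRr1 // ltW.
    by rewrite -Mp; field; rewrite pn0 gt_eqF // powR_gt0.
  have := positive_probability_ge hp z0 l0 hz hX hXp.
  rewrite lp -M2 powR_mulrn ?(ltW c20) //.
  have fP : P [set w | 0 < X w] \is a fin_num.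
    by rewrite fin_num_measure // gt0_preimage_itv; exact: measurable_preimage_itv.
  rewrite -[in X in _ -> X](fineK fP) lee_fin.
  set Q := fine _ => main.
  have mainQ : x0 ^+ 2 * C <= z * (1 + z) * Q.
    have B0 : 0 < (p - 1) * (p - 2) / p.
      by rewrite divr_gt0 ?mulr_gt0 //; lra.
    rewrite -(ler_pM2l B0).
    move: main; rewrite /majorant_level -[leRHS]mulrA.
    apply: le_trans; rewrite -CE /l exprMn.
    by rewrite le_eqVlt; apply/orP; left; apply/eqP; field.
  have C0 : 0 <= C by rewrite powR_ge0.
  have zz0 : 0 < z * (1 + z) by rewrite mulr_gt0 ?addr_gt0.
  rewrite -(ler_pM2l zz0); apply: le_trans mainQ.
  have := ler_wpM2l (divr_ge0 C0 (ler0n _ 4)) z_le.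
  by lra.
- rewrite gt0_preimage_itv ge0_preimage_itv le_measure ?inE //.
  + exact: measurable_preimage_itv.
  + exact: measurable_preimage_itv.
  + by move=> w /=; rewrite !in_itv /= !andbT => /ltW.
Qed.
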